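(* Let $\mathcal X=\mathbb R$ and let $\mathcal H=\{h \mid \exists\,[a_i,b_i],\ i\in[k],\ \text{s.t. } h(x)=1\iff x\in\bigcup_{i=1}^k[a_i,b_i]\}$ be the class of unions of $k$ intervals over $\mathbb R$. Let $I$ be the class of intervals over $\mathbb R$ and let $Q=\{(T,z)\mid T\in I,\ z\in\{\pm1\}\}$. There is a learner $\mathcal A$ such that for every set $S\subseteq\mathbb R$ of $n$ examples labeled by any $h^*\in\mathcal H$, and for every labeling domain $L\supseteq S$ (possibly unknown to $\mathcal A$), $\mathcal A$ runs in $O((\tau+n)k\log n)$ time, makes $O(k\log n)$ queries from $Q$ and labels every example in $S$ correctly, where $\tau$ is the running time to implement a single region query.
   Context: Region-query model. Hypotheses are functions $\mathcal X\to\{\pm1\}$; an unknown target $h^*\in\mathcal H$ labels the examples. A region query is a pair $(T,z)$ with $T\subseteq\mathcal X$, $z\in\{\pm1\}$. Given a finite dataset $S$ and a labeling domain $L$ with $S\subseteq L\subseteq\mathcal X$, the labeler answers $(T,z)$ with $q(T,z)=1$ if $h^*(x)=z$ for all $x\in T\cap L$ and $0$ otherwise; if $T\cap L=\emptyset$ the answer may be arbitrary. The learner is given $\mathcal H$, $S$ and $Q$ (not $h^*$), adaptively submits queries from $Q$, and finally outputs a label for each example of $S$. Implied constants are absolute; logarithms in asymptotic bounds are read as $\max\{1,\log(\cdot)\}$. *)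

(* Defs.v *)
From mathcomp Require Import all_boot all_order all_algebra.
From mathcomp Require Import all_classical all_reals all_analysis.

Set Implicit Arguments.
Unset Strict Implicit.
Unset Printing Implicit Defensive.

Import Order.TTheory GRing.Theory Num.Theory.

Local Open Scope classical_set_scope.
Local Open Scope ring_scope.

(* Labels are booleans: [true] is the label +1 and [false] is the label -1. *)

Definition region_query (X : Type) : Type := (set X * bool)%type.

(* The queries asked so far with their answers, most recent first. *)
Definition transcript (X : Type) : Type := seq (region_query X * bool).

(* The answer may depend on the whole transcript. This matters only for the
   answers that the model leaves arbitrary: they may be adversarial, and need
   not be a function of the query. *)
Definition labeler (X : Type) : Type := transcript X -> region_query X -> bool.

Definition labeler_for (X : Type) (L : set X) (h : X -> bool)
    (ask : labeler X) : Prop :=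
  forall (w : transcript X) (T : set X) (z : bool), T `&` L !=set0 ->
    ask w (T, z) = true <-> (forall x, (T `&` L) x -> h x = z).

(* The endpoints of each interval are unconstrained; `[a i, b i] is empty when
   b i < a i. *)
Definition unions_of_intervals (R : realType) (k : nat) : set (R -> bool) :=
  [set h | exists a b : 'I_k -> R,
     forall x, h x = true <-> (\bigcup_(i : 'I_k) [set` `[a i, b i]]) x].

Definition interval_queries (R : realType) : set (region_query R) :=
  [set q | is_interval q.1].

Definition log1 (R : realType) (n : nat) : R := Num.max 1 (ln n%:R).

(* Running time is measured on a real RAM, programmed in a small imperative
   language. The memory consists of arrays of natural numbers and arrays of
   real numbers. Array names are constants of the program, so that a program
   uses finitely many of them; cells are addressed by computed indices. Reals
   can be compared and combined by field operations, but there is no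
   conversion from reals to natural numbers (no floor). *)

Inductive nexp : Type :=
| NConst of nat
| NGet of nat & nexp
| NAdd of nexp & nexp
| NSub of nexp & nexp
| NHalf of nexp.

Inductive rexp : Type :=
| ROfNat of nexp
| RGet of nat & nexp
| RAdd of rexp & rexp
| RSub of rexp & rexp
| RMul of rexp & rexp
| RDiv of rexp & rexp.

Inductive bexp : Type :=
| BLeN of nexp & nexp
| BLeR of rexp & rexp
| BNot of bexp
| BAnd of bexp & bexp.

(* [Query a i J z] submits the region query (J, z) and stores the answer (1 or
   0) in cell [i] of the [a]-th array of natural numbers. The shape of [J]
   (open, closed or infinite at either end) and the label [z] are constants of
   the instruction; the endpoints are computed. *)
Inductive cmd : Type :=
| Skip
| SetN of nat & nexp & nexp
| SetR of nat & nexp & rexp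
| Query of nat & nexp & interval rexp & bool
| Seq of cmd & cmd
| If of bexp & cmd & cmd
| While of bexp & cmd.

Record state (R : realType) : Type := State {
  nmem : nat -> nat -> nat;
  rmem : nat -> nat -> R;
  asked : transcript R
}.

Definition update (V : Type) (m : nat -> nat -> V) (a i : nat) (v : V) :
    nat -> nat -> V :=
  fun a' i' => if (a' == a) && (i' == i) then v else m a' i'.

Fixpoint neval (R : realType) (s : state R) (e : nexp) : nat :=
  match e with
  | NConst c => c
  | NGet a i => nmem s a (neval s i)
  | NAdd e1 e2 => (neval s e1 + neval s e2)%N
  | NSub e1 e2 => (neval s e1 - neval s e2)%N
  | NHalf e1 => (neval s e1)./2
  end.

Fixpoint reval (R : realType) (s : state R) (e : rexp) : R :=
  match e with
  | ROfNat e1 => (neval s e1)%:R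
  | RGet a i => rmem s a (neval s i)
  | RAdd e1 e2 => reval s e1 + reval s e2
  | RSub e1 e2 => reval s e1 - reval s e2
  | RMul e1 e2 => reval s e1 * reval s e2
  | RDiv e1 e2 => reval s e1 / reval s e2
  end.

Fixpoint beval (R : realType) (s : state R) (e : bexp) : bool :=
  match e with
  | BLeN e1 e2 => (neval s e1 <= neval s e2)%N
  | BLeR e1 e2 => reval s e1 <= reval s e2
  | BNot e1 => ~~ beval s e1
  | BAnd e1 e2 => beval s e1 && beval s e2
  end.

Definition bound_eval (R : realType) (s : state R) (b : itv_bound rexp) :
    itv_bound R :=
  match b with
  | BSide c e => BSide c (reval s e)
  | BInfty c => BInfty R c
  end.

Definition itv_eval (R : realType) (s : state R) (J : interval rexp) :
    interval R :=
  let: Interval l u := J in Interval (bound_eval s l) (bound_eval s u).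

Definition query_of (R : realType) (s : state R) (J : interval rexp)
    (z : bool) : region_query R :=
  ([set` itv_eval s J], z).

(* [exec ask tau c s t s']: started in [s] and interacting with the labeler
   [ask], the command [c] halts in [s'] after [t] units of time. A query costs
   [tau]; every other instruction and every evaluation of a test costs 1
   (expressions have a size that depends only on the program). Execution is
   deterministic for a given labeler, so a derivation also shows that the
   unique run halts. *)
Inductive exec (R : realType) (ask : labeler R) (tau : nat) :
    cmd -> state R -> nat -> state R -> Prop :=
| ExecSkip s :
    exec ask tau Skip s 1%N s
| ExecSetN s a i e :
    exec ask tau (SetN a i e) s 1%N
      (State (update (nmem s) a (neval s i) (neval s e)) (rmem s) (asked s))
| ExecSetR s a i e :
    exec ask tau (SetR a i e) s 1%N
      (State (nmem s) (update (rmem s) a (neval s i) (reval s e)) (asked s))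
| ExecQuery s a i J z :
    exec ask tau (Query a i J z) s tau
      (let q := query_of s J z in
       let ans := ask (asked s) q in
       State (update (nmem s) a (neval s i) (nat_of_bool ans)) (rmem s)
         ((q, ans) :: asked s))
| ExecSeq c1 c2 s t1 s1 t2 s2 :
    exec ask tau c1 s t1 s1 -> exec ask tau c2 s1 t2 s2 ->
    exec ask tau (Seq c1 c2) s (t1 + t2)%N s2
| ExecIfTrue b c1 c2 s t s' :
    beval s b = true -> exec ask tau c1 s t s' ->
    exec ask tau (If b c1 c2) s t.+1 s'
| ExecIfFalse b c1 c2 s t s' :
    beval s b = false -> exec ask tau c2 s t s' ->
    exec ask tau (If b c1 c2) s t.+1 s'
| ExecWhileFalse b c s :
    beval s b = false -> exec ask tau (While b c) s 1%N s
| ExecWhileTrue b c s t1 s1 t2 s2 :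
    beval s b = true -> exec ask tau c s t1 s1 ->
    exec ask tau (While b c) s1 t2 s2 ->
    exec ask tau (While b c) s (t1 + t2).+1 s2.

(* Input: n and k in cells 0 and 1 of array 0 of natural numbers, and the
   examples, in the given order, in array 0 of reals; all other cells are 0. *)
Definition input (R : realType) (k : nat) (S : seq R) : state R :=
  State (fun a i => if a == 0%N then nth 0%N [:: size S; k] i else 0%N)
        (fun a i => if a == 0%N then nth 0 S i else 0)
        [::].

(* Output: the label of the i-th example of the input, encoded as 1 for +1 and
   0 for -1, is in cell i of array 1 of natural numbers. *)
Definition labels_correctly (R : realType) (h : R -> bool) (S : seq R)
    (s : state R) : Prop :=
  forall i, (i < size S)%N -> nmem s 1%N i = nat_of_bool (h (nth 0 S i)).

(* Main.v *)
(* The learner sorts the examples by merge sort, which takes O(log n) passes of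
   linear time, and then runs k + 1 rounds. A round starts at the first
   unlabelled example p in sorted order: it finds by binary search the longest
   block of examples starting at p whose query for +1 succeeds, labels it, and
   does the same for -1 from the example q that follows. If an example r is
   left over, the two failed queries give points y1 in [p, q] and y2 in [q, r]
   of the labeling domain with labels -1 and +1. Since y1 <= y2, the target has
   an interval whose left end lies in (p, r]. These left ends differ from round
   to round, so that at most k rounds leave an example over. *)

Require Import Defs.
From mathcomp Require Import all_boot all_order all_algebra.
From mathcomp Require Import all_classical all_reals all_analysis.
From mathcomp Require Import zify lra.

Set Implicit Arguments.
Unset Strict Implicit.
Unset Printing Implicit Defensive.

Import Order.TTheory GRing.Theory Num.Theory.

Local Open Scope classical_set_scope.
Local Open Scope ring_scope.

(** * A program logic with running times *)

Fixpoint narrays (c : cmd) : seq nat :=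
  match c with
  | SetN a _ _ | Query a _ _ _ => [:: a]
  | Seq c1 c2 | If _ c1 c2 => narrays c1 ++ narrays c2
  | While _ c1 => narrays c1
  | _ => [::]
  end.

Fixpoint sets_reals (c : cmd) : bool :=
  match c with
  | SetR _ _ _ => true
  | Seq c1 c2 | If _ c1 c2 => sets_reals c1 || sets_reals c2
  | While _ c1 => sets_reals c1
  | _ => false
  end.

Fixpoint submits (c : cmd) : bool :=
  match c with
  | Query _ _ _ _ => true
  | Seq c1 c2 | If _ c1 c2 => submits c1 || submits c2
  | While _ c1 => submits c1
  | _ => false
  end.

(** The value at [While] is a placeholder: loops are timed by [runs_while]. *)
Fixpoint cost (tau : nat) (c : cmd) : nat :=
  match c with
  | Query _ _ _ _ => tau
  | Seq c1 c2 => cost tau c1 + cost tau c2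
  | If _ c1 c2 => (maxn (cost tau c1) (cost tau c2)).+1
  | _ => 1%N
  end.

Section Hoare.
Context (R : realType) (ask : labeler R) (tau : nat).
Implicit Types (c : cmd) (s : state R) (Q : state R -> Prop).

(** What [c] may change is overestimated from its syntax, so that invariants can leave out whatever
    a loop never writes. *)
Definition frame c s s' : Prop :=
  [/\ forall a, a \notin narrays c -> nmem s' a = nmem s a,
      ~~ sets_reals c -> rmem s' = rmem s
    & ~~ submits c -> asked s' = asked s].

Lemma frame_refl c s : frame c s s.
Proof. by split. Qed.

Lemma frame_trans c s1 s2 s3 : frame c s1 s2 -> frame c s2 s3 -> frame c s1 s3.
Proof.
move=> [N1 R1 A1] [N2 R2 A2]; split=> [a ac|rc|qc].
- by rewrite N2 ?N1.
- by rewrite R2 ?R1.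
- by rewrite A2 ?A1.
Qed.

Lemma frame_sub c c' s s' : {subset narrays c <= narrays c'} ->
  (sets_reals c -> sets_reals c') -> (submits c -> submits c') ->
  frame c s s' -> frame c' s s'.
Proof.
move=> sub rsub qsub [N1 R1 A1]; split=> [a ac|rc|qc].
- by apply: N1; apply: contra ac => /sub.
- by apply: R1; apply: contra rc.
- by apply: A1; apply: contra qc.
Qed.

Lemma exec_frame c s t s' : exec ask tau c s t s' -> frame c s s'.
Proof.
elim=> {c s t s'}.
- by move=> s; split.
- move=> s a i e; split=> //= a'; rewrite inE => /negPf a'a.
  by apply/funext => i'; rewrite /update a'a.
- by move=> s a i e; split.
- move=> s a i J z; split=> //= a'; rewrite inE => /negPf a'a.
  by apply/funext => i'; rewrite /update a'a.
- move=> c1 c2 s t1 s1 t2 s2 _ F1 _ F2; apply: (@frame_trans _ _ s1).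
  + by apply: frame_sub F1 => [a|/= ->|/= ->] //; rewrite /= mem_cat => ->.
  + apply: frame_sub F2 => [a|/= ->|/= ->]; rewrite /= ?mem_cat ?orbT //.
    by move=> ->; rewrite orbT.
- move=> b c1 c2 s t s' _ _ F1.
  by apply: frame_sub F1 => [a|/= ->|/= ->] //; rewrite /= mem_cat => ->.
- move=> b c1 c2 s t s' _ _ F1.
  apply: frame_sub F1 => [a|/= ->|/= ->]; rewrite /= ?mem_cat ?orbT //.
  by move=> ->; rewrite orbT.
- by move=> b c s _; apply: frame_refl.
- by move=> b c s t1 s1 t2 s2 _ _ F1 _ F2; apply: (@frame_trans _ _ s1).
Qed.

Definition runs c s (T : nat) Q : Prop :=
  exists t s', [/\ exec ask tau c s t s', (t <= T)%N & Q s'].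

Lemma runs_mono c s T T' Q Q' : (T <= T')%N -> (forall s', Q s' -> Q' s') ->
  runs c s T Q -> runs c s T' Q'.
Proof.
move=> TT QQ [t [s' [E tT Qs]]]; exists t, s'; split=> //; last exact: QQ.
exact: leq_trans tT TT.
Qed.

Lemma runs_frame c s T Q :
  runs c s T Q -> runs c s T (fun s' => frame c s s' /\ Q s').
Proof.
move=> [t [s' [E tT Qs]]]; exists t, s'; split=> //; split=> //.
exact: exec_frame E.
Qed.

Lemma runs_seq c1 c2 s T1 T2 Q :
  runs c1 s T1 (fun s1 => runs c2 s1 T2 Q) -> runs (Seq c1 c2) s (T1 + T2) Q.
Proof.
move=> [t1 [s1 [E1 le1 [t2 [s2 [E2 le2 Qs]]]]]].
by exists (t1 + t2)%N, s2; split=> //; [apply: ExecSeq E1 E2 | apply: leq_add].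
Qed.

(* [While] is sent to [False]: [wp] is only used on loop-free code. *)
Fixpoint wp c s Q : Prop :=
  match c with
  | Skip => Q s
  | SetN a i e =>
      Q (State (update (nmem s) a (neval s i) (neval s e)) (rmem s) (asked s))
  | SetR a i e =>
      Q (State (nmem s) (update (rmem s) a (neval s i) (reval s e)) (asked s))
  | Query a i J z =>
      let q := query_of s J z in
      let ans := ask (asked s) q in
      Q (State (update (nmem s) a (neval s i) (nat_of_bool ans)) (rmem s)
           ((q, ans) :: asked s))
  | Seq c1 c2 => wp c1 s (fun s1 => wp c2 s1 Q)
  | If b c1 c2 => if beval s b then wp c1 s Q else wp c2 s Q
  | While _ _ => False
  end.

Lemma wp_mono c s Q Q' : (forall s', Q s' -> Q' s') -> wp c s Q -> wp c s Q'.
Proof.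
elim: c s Q Q' => [|a i e|a i e|a i J z|c1 IH1 c2 IH2|b c1 IH1 c2 IH2|b c _]
  s Q Q' QQ //=; try exact: QQ.
- by apply: IH1 => s1; apply: IH2.
- by case: ifP => _; [apply: IH1 | apply: IH2].
Qed.

Lemma runs_wp c s Q : wp c s Q -> runs c s (cost tau c) Q.
Proof.
elim: c s Q => [|a i e|a i e|a i J z|c1 IH1 c2 IH2|b c1 IH1 c2 IH2|b c _]
  s Q //= W.
- by do 2!eexists; split; [apply: ExecSkip | | exact: W].
- by do 2!eexists; split; [apply: ExecSetN | | exact: W].
- by do 2!eexists; split; [apply: ExecSetR | | exact: W].
- by do 2!eexists; split; [apply: ExecQuery | | exact: W].
- by apply: runs_seq; apply: IH1; apply: wp_mono W => s1; apply: IH2.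
- move: W; case bE: (beval s b).
  + move=> /IH1 [t [s' [E tT Qs]]]; exists t.+1, s'; split=> //.
      exact: ExecIfTrue.
    by rewrite ltnS leq_max tT.
  + move=> /IH2 [t [s' [E tT Qs]]]; exists t.+1, s'; split=> //.
      exact: ExecIfFalse.
    by rewrite ltnS leq_max tT orbT.
Qed.

(** The variant [m] bounds the iterations still to come. Each costs [T] plus one unit for its test,
    and the test that fails costs the last unit. *)
Lemma runs_while (I : nat -> state R -> Prop) b c T m s :
  (forall m' s', frame c s s' -> I m' s' -> beval s' b ->
     (0 < m')%N /\ runs c s' T (I m'.-1)) ->
  I m s ->
  runs (While b c) s (m * T.+1).+1
    (fun s' => exists m', I m' s' /\ beval s' b = false).
Proof.
move=> step; suff loop s1 : frame c s s1 -> I m s1 ->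
  runs (While b c) s1 (m * T.+1).+1
    (fun s' => exists m', I m' s' /\ beval s' b = false).
  by apply: loop; apply: frame_refl.
elim: m s1 => [|m IHm] s1 F Is.
  case bE: (beval s1 b); first by have [] := step _ _ F Is bE.
  exists 1%N, s1; split=> //; [exact: ExecWhileFalse | by exists 0%N].
case bE: (beval s1 b); last first.
  exists 1%N, s1; split=> //; [exact: ExecWhileFalse | by exists m.+1].
have [_ [t1 [s2 [E1 le1 Is2]]]] := step _ _ F Is bE.
have [t2 [s3 [E2 le2 Qs]]] := IHm _ (frame_trans F (exec_frame E1)) Is2.
exists (t1 + t2).+1, s3; split=> //; first exact: ExecWhileTrue bE E1 E2.
by rewrite mulSn; lia.
Qed.

End Hoare.

(** * Runs of sorted elements *)

Section Runs.
Context (T : Type) (le : rel T).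

Fixpoint merge_pairs (rs : seq (seq T)) : seq (seq T) :=
  match rs with
  | a :: b :: rs' => merge le a b :: merge_pairs rs'
  | _ => rs
  end.

(* Every run has length [w], except that the list may end with a shorter run
   followed by empty ones. *)
Fixpoint runs_of_width (w : nat) (rs : seq (seq T)) : bool :=
  if rs is a :: rs' then
    (size a == minn w (size (flatten rs))) && runs_of_width w rs'
  else true.

Lemma pair_ind (P : seq (seq T) -> Prop) :
  P [::] -> (forall a, P [:: a]) ->
  (forall a b rs, P rs -> P [:: a, b & rs]) -> forall rs, P rs.
Proof.
move=> P0 P1 P2; fix IH 1 => -[|a [|b rs]].
- exact: P0.
- exact: P1.
- exact: (P2 a b rs (IH rs)).
Qed.

Lemma merge_nilr (l : seq T) : merge le l [::] = l.
Proof. by case: l. Qed.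

Lemma merge_headl a l r : (if r is b :: _ then le a b else true) ->
  merge le (a :: l) r = a :: merge le l r.
Proof. by case: r => [|b r] /= => [_|->]; rewrite ?merge_nilr. Qed.

Lemma merge_headr b l r : (if l is a :: _ then ~~ le a b else true) ->
  merge le l (b :: r) = b :: merge le l r.
Proof. by case: l => [|a l] //= /negPf ->. Qed.

(** Missing runs are read as empty ones, just as [load_runs] loads empty runs once the input is used
    up. *)
Lemma flatten_merge_pairs rs : flatten (merge_pairs rs) =
  merge le (head [::] rs) (head [::] (behead rs))
    ++ flatten (merge_pairs (behead (behead rs))).
Proof. by case: rs => [|a [|b rs]] //=; rewrite merge_nilr. Qed.

Lemma size_flatten_merge_pairs rs :
  size (flatten (merge_pairs rs)) = size (flatten rs).
Proof.
elim/pair_ind: rs => [|a|a b rs IH] //=.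
by rewrite !size_cat size_merge size_cat IH addnA.
Qed.

(** Two neighbours have lengths min(w, N) and min(w, N - min(w, N)), where N counts the elements
    from the first of them on; these add up to min(2w, N). *)
Lemma runs_of_width_merge_pairs w rs :
  runs_of_width w rs -> runs_of_width (w + w) (merge_pairs rs).
Proof.
elim/pair_ind: rs => [|a|a b rs IH] //=.
  by rewrite cats0 => /andP[/eqP ? _]; rewrite andbT; apply/eqP; lia.
move=> /and3P[/eqP sa /eqP sb /IH ->]; rewrite andbT.
move: sa sb; rewrite !size_cat size_flatten_merge_pairs size_merge !size_cat.
by move=> ? ?; apply/eqP; lia.
Qed.

Lemma sorted_merge_pairs rs : total le ->
  all (sorted le) rs -> all (sorted le) (merge_pairs rs).
Proof.
move=> le_total; elim/pair_ind: rs => [|a|a b rs IH] //=.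
by move=> /and3P[sa sb /IH ->]; rewrite merge_sorted.
Qed.

Lemma runs_of_width_split w rs : runs_of_width w rs ->
  [/\ flatten rs = head [::] rs ++ flatten (behead rs),
      size (head [::] rs) = minn w (size (flatten rs))
    & runs_of_width w (behead rs)].
Proof.
case: rs => [|a rs] /=; first by rewrite minn0.
by move=> /andP[/eqP -> ->].
Qed.

Lemma runs_of_width1 (s : seq T) : runs_of_width 1 [seq [:: i] | i <- s].
Proof. by elim: s => //= a s ->; rewrite minnC. Qed.

(** At such a width the first run absorbs everything; this is where the sorting loop stops. *)
Lemma sorted_single_run w rs : runs_of_width w rs -> all (sorted le) rs ->
  (size (flatten rs) <= w)%N -> sorted le (flatten rs).
Proof.
case: rs => [|a rs] //= /andP[/eqP sa _] /andP[sorted_a _] n_w.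
rewrite size_cat in sa n_w; have rs0 : size (flatten rs) = 0%N by lia.
by rewrite (size0nil rs0) cats0.
Qed.

End Runs.

Lemma perm_flatten_merge_pairs (T : eqType) (le : rel T) rs :
  perm_eq (flatten (merge_pairs le rs)) (flatten rs).
Proof.
elim/pair_ind: rs => [|a|a b rs IH] //=.
by rewrite catA; apply: perm_cat => //; rewrite perm_merge.
Qed.

(** * Contents of a memory array as lists *)

Definition slice (m : nat -> nat) (i l : nat) : seq nat :=
  [seq m x | x <- iota i l].

Lemma slice_cons m i l : (0 < l)%N -> slice m i l = m i :: slice m i.+1 l.-1.
Proof. by case: l. Qed.

Lemma slice_rcons m i l : slice m i l.+1 = rcons (slice m i l) (m (i + l)%N).
Proof. by rewrite /slice -cats1 -[in LHS]addn1 iotaD map_cat. Qed.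

Lemma slice_cat m i l u v : slice m i l = u ++ v ->
  u = slice m i (size u) /\ v = slice m (i + size u) (l - size u).
Proof.
move=> E; have lE : l = (size u + size v)%N.
  by rewrite -size_cat -E size_map size_iota.
move: E; rewrite lE addKn /slice iotaD map_cat => /eqP.
by rewrite eqseq_cat ?size_map ?size_iota // => /andP[/eqP uE /eqP vE].
Qed.

Lemma size_slice m i l : size (slice m i l) = l.
Proof. by rewrite size_map size_iota. Qed.

Lemma nth_slice m l j : (j < l)%N -> nth 0%N (slice m 0 l) j = m j.
Proof. by move=> j_l; rewrite (nth_map 0%N) ?size_iota // nth_iota. Qed.

Lemma eq_slice m m' i l :
  (forall x, (i <= x < i + l)%N -> m x = m' x) -> slice m i l = slice m' i l.
Proof. by move=> E; apply/eq_in_map => x; rewrite mem_iota; exact: E. Qed.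

(** * The sorting program *)

(* A scalar variable is cell 0 of its own array, so that [frame] treats scalars
   and arrays alike; all scalars are initially 0. [aP] holds the permutation
   that sorts the examples, [aB] is the merge buffer. *)
Local Notation aN := 0%N (only parsing).
Local Notation aOut := 1%N (only parsing).
Local Notation aP := 2%N (only parsing).
Local Notation aB := 3%N (only parsing).
Local Notation vw := 4%N (only parsing).
Local Notation vo := 5%N (only parsing).
Local Notation vi := 6%N (only parsing).
Local Notation ve1 := 7%N (only parsing).
Local Notation vj := 8%N (only parsing).
Local Notation ve2 := 9%N (only parsing).
Local Notation vp := 10%N (only parsing).
Local Notation vlo := 11%N (only parsing).
Local Notation vhi := 12%N (only parsing).
Local Notation vmid := 13%N (only parsing).
Local Notation vans := 14%N (only parsing).
Local Notation vr := 15%N (only parsing).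

Local Notation "'val' v" := (NGet v (NConst 0)) (at level 9, v at level 8).
Local Notation "v ::= e" := (SetN v (NConst 0) e) (at level 60).
Local Notation "c1 ;; c2" := (Seq c1 c2) (at level 65, right associativity).
Local Notation incr v := (v ::= NAdd (val v) (NConst 1)).
Local Notation lt e1 e2 := (BLeN (NAdd e1 (NConst 1)) e2).
Local Notation len := (val aN).
(* Truncated subtraction turns this into [minn e n]. *)
Local Notation capped e := (NSub e (NSub e len)).
Local Notation example e := (RGet 0 (NGet aP e)).

Definition fill (a : nat) (e : nexp) : cmd :=
  While (lt (val vo) len) (SetN a (val vo) e ;; incr vo).

(** Once both runs are exhausted, [vo] equals the end [ve2] of the second one, so the next pair
    starts at [vo]. A pass starts with all bounds at 0, hence its first call loads as well. *)
Definition load_runs : cmd :=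
  If (BAnd (BLeN (val ve1) (val vi)) (BLeN (val ve2) (val vj)))
     (vi ::= val vo ;; ve1 ::= capped (NAdd (val vo) (val vw)) ;;
      vj ::= val ve1 ;; ve2 ::= capped (NAdd (val ve1) (val vw)))
     Skip.

(** Ties go to the left run, as in [merge]. Reading beyond the end of a run is harmless: memory is
    total and the guards override the comparison. *)
Definition output_min : cmd :=
  If (BAnd (lt (val vi) (val ve1))
        (BNot (BAnd (lt (val vj) (val ve2))
                 (BNot (BLeR (example (val vi)) (example (val vj)))))))
     (SetN aB (val vo) (NGet aP (val vi)) ;; incr vi)
     (SetN aB (val vo) (NGet aP (val vj)) ;; incr vj) ;;
  incr vo.

Definition merge_pass : cmd :=
  vo ::= NConst 0 ;; vi ::= NConst 0 ;; ve1 ::= NConst 0 ;;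
  vj ::= NConst 0 ;; ve2 ::= NConst 0 ;;
  While (lt (val vo) len) (load_runs ;; output_min).

Definition sort_round : cmd :=
  merge_pass ;; (vo ::= NConst 0 ;; fill aP (NGet aB (val vo))) ;;
  vw ::= NAdd (val vw) (val vw).

Definition sort_examples : cmd :=
  fill aP (val vo) ;; vw ::= NConst 1 ;; While (lt (val vw) len) sort_round.

(** * Correctness and running time of the merge sort *)

Section Program.
Context (R : realType) (ask : labeler R) (tau : nat).
Implicit Types (s : state R).
Local Notation runs := (runs ask tau).

Lemma runs_fill a e (g : nat -> nat) s :
  a \notin [:: aN; vo] -> nmem s vo 0 = 0%N ->
  (forall s', frame (fill a e) s s' -> neval s' e = g (nmem s' vo 0)) ->
  runs (fill a e) s (nmem s aN 0 * 3).+1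
    (fun s' => forall i, (i < nmem s aN 0)%N -> nmem s' a i = g i).
Proof.
rewrite !inE negb_or => /andP[a0 a5] o0 eE; set n := nmem s aN 0.
have := @runs_while R ask tau (fun m s' =>
  [/\ (nmem s' vo 0 + m = n)%N, nmem s' aN 0 = n
    & forall i, (i < nmem s' vo 0)%N -> nmem s' a i = g i])
  (lt (val vo) len) (SetN a (val vo) e ;; incr vo) 2 n s.
move=> H; apply: runs_mono (H _ _) => //; last by rewrite o0.
- move=> s' [m [[om nE E]]] /= b i i_n.
  by apply: E; rewrite nE in b; lia.
- move=> m s' F [om nE E] /= b; split; first by rewrite nE in b; lia.
  apply: runs_wp => /=; rewrite /update /= (negPf a5) eq_sym (negPf a5) /=.
  rewrite eq_sym in a0; rewrite (negPf a0) /=; split; [lia | by [] | ].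
  move=> i i_o; rewrite eqxx eE //=; case: eqP => [->//|/= ni].
  by apply: E; lia.
Qed.

(* The final output of the pass is already determined by the state: what has
   been written, the merge of what is left of the two current runs, and the
   pairwise merge of the runs not yet loaded. *)
Record merge_inv (n w : nat) (f : nat -> nat) (x : nat -> R)
    (target : seq nat) (m : nat) s : Prop := MergeInv {
  mi_len : nmem s aN 0 = n;
  mi_w : nmem s vw 0 = w;
  mi_P : nmem s aP = f;
  mi_x : rmem s 0%N = x;
  mi_o : (nmem s vo 0 + m = n)%N;
  mi_e2 : (nmem s ve2 0 <= n)%N;
  mi_pos : (nmem s vo 0 + (nmem s ve1 0 - nmem s vi 0)
              + (nmem s ve2 0 - nmem s vj 0) = nmem s ve2 0)%N;
  mi_out : exists rest : seq (seq nat),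
    [/\ slice f (nmem s ve2 0) (n - nmem s ve2 0) = flatten rest,
        runs_of_width w rest
      & slice (nmem s aB) 0 (nmem s vo 0)
          ++ merge (fun a b => x a <= x b)
               (slice f (nmem s vi 0) (nmem s ve1 0 - nmem s vi 0))
               (slice f (nmem s vj 0) (nmem s ve2 0 - nmem s vj 0))
          ++ flatten (merge_pairs (fun a b => x a <= x b) rest) = target]
}.

Definition run_loaded s : Prop :=
  (nmem s vi 0 < nmem s ve1 0)%N || (nmem s vj 0 < nmem s ve2 0)%N.

(** Exhausted runs contribute nothing to the predicted output, so replacing them by the first two
    runs of [rest] leaves it unchanged. As [m] and [w] are positive, some output is missing and the
    first run loaded is non-empty. *)
Lemma runs_load_runs n w f x target m s : (0 < m)%N -> (0 < w)%N ->
  merge_inv n w f x target m s ->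
  runs load_runs s 5
    (fun s' => merge_inv n w f x target m s' /\ run_loaded s').
Proof.
move=> m0 w0 [nE wE PE xE om e2n pos [rest [restE rest_w out]]].
apply: runs_wp => /=; case: ifP => [|b]; last first.
  split; last by rewrite /run_loaded; lia.
  by split=> //; exists rest.
move=> /andP[b1 b2].
have oE : nmem s vo 0 = nmem s ve2 0 by lia.
have [E1 sz1 rest1_w] := runs_of_width_split rest_w.
have [E2 sz2 rest2_w] := runs_of_width_split rest1_w.
have szE : (size (flatten rest) = n - nmem s ve2 0)%N.
  by rewrite -restE size_slice.
rewrite szE in sz1.
rewrite E1 in restE; have [l1E rest1E] := slice_cat restE.
have sz1' := congr1 size rest1E; rewrite size_slice in sz1'.
rewrite sz1' in sz2.
rewrite E2 in rest1E; have [r1E rest2E] := slice_cat (esym rest1E).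
set l1 := head _ _ in E1 sz1 restE l1E rest1E sz1' sz2 r1E rest2E.
set r1 := head _ _ in E2 rest1E sz2 r1E rest2E.
rewrite /update /=.
set e1' := (nmem s 5 0 + nmem s 4 0 - _)%N.
have e1'E : e1' = (nmem s ve2 0 + size l1)%N by rewrite /e1' wE nE; lia.
set e2' := (e1' + nmem s 4 0 - _)%N.
have e2'E : e2' = (e1' + size r1)%N by rewrite /e2' wE nE; lia.
split; first split=> //=; rewrite ?/run_loaded /= /update /=; try lia.
exists (behead (behead rest)); split=> //.
  by rewrite rest2E e2'E e1'E; congr slice; lia.
rewrite -out (_ : nmem s ve1 0 - nmem s vi 0 = 0)%N; last lia.
rewrite (_ : nmem s ve2 0 - nmem s vj 0 = 0)%N; last lia.
rewrite [merge _ (slice f (nmem s vi 0) 0) _]/= [in RHS]flatten_merge_pairs.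
congr (_ ++ (merge _ _ _ ++ _)).
  by rewrite -/l1 l1E oE; congr slice; lia.
by rewrite -/r1 r1E e1'E; congr slice; lia.
Qed.

(** The cell written receives the head of the merge of the two current runs, so one element moves
    from the second term of [mi_out] to the first. *)
Lemma runs_output_min n w f x target m s : (0 < m)%N ->
  merge_inv n w f x target m s -> run_loaded s ->
  runs output_min s 4 (merge_inv n w f x target m.-1).
Proof.
move=> m0 [nE wE PE xE om e2n pos [rest [restE rest_w out]]] loaded.
have cat_out a o : slice (update (nmem s) aB o a aB) 0 o.+1
    = rcons (slice (nmem s aB) 0 o) a.
  rewrite slice_rcons add0n /update !eqxx /=; congr rcons.
  by apply: eq_slice => y y_o; case: eqP => // yo; lia.
apply: runs_wp => /=; rewrite xE PE; set b := (_ && ~~ _).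
case: ifP => [|b_false].
- move=> /andP[i_e1 j_min].
  split=> //=; rewrite /update /=; try lia.
  exists rest; split=> //.
  rewrite -out (_ : nmem s vo 0 + 1 = (nmem s vo 0).+1)%N; last lia.
  rewrite -[LHS]/(slice (update (nmem s) aB (nmem s vo 0) (f (nmem s vi 0)) aB)
    0 _ ++ _) cat_out cat_rcons.
  rewrite [in RHS](slice_cons f (nmem s vi 0)); last lia.
  rewrite merge_headl ?cat_cons; last first.
    move: j_min; rewrite addn1.
    case: (ltnP (nmem s vj 0) (nmem s ve2 0)) => [j_e2|j_e2] /=; last first.
      by rewrite (eqP (_ : nmem s ve2 0 - nmem s vj 0 == 0)%N).
    by rewrite negbK slice_cons ?subn_gt0.
  by congr (_ ++ _ :: merge _ (slice _ _ _) _ ++ _); lia.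
- have j_e2 : (nmem s vj 0 < nmem s ve2 0)%N.
    move: loaded b_false; rewrite /run_loaded /b.
    by case: (ltnP (nmem s vj 0)); lia.
  split=> //=; rewrite /update /=; try lia.
  exists rest; split=> //.
  rewrite -out (_ : nmem s vo 0 + 1 = (nmem s vo 0).+1)%N; last lia.
  rewrite -[LHS]/(slice (update (nmem s) aB (nmem s vo 0) (f (nmem s vj 0)) aB)
    0 _ ++ _) cat_out cat_rcons.
  rewrite [in RHS](slice_cons f (nmem s vj 0)); last lia.
  rewrite merge_headr ?cat_cons; last first.
    case: (ltnP (nmem s vi 0) (nmem s ve1 0)) => [i_e1|i_e1]; last first.
      by rewrite (eqP (_ : nmem s ve1 0 - nmem s vi 0 == 0)%N).
    rewrite slice_cons ?subn_gt0 //.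
    by move: b_false; rewrite /b !addn1 i_e1 j_e2 /= negbK => ->.
  by congr (_ ++ _ :: merge _ _ (slice _ _ _) ++ _); lia.
Qed.

Lemma runs_merge_pass s rs (x := rmem s 0%N) (n := nmem s aN 0)
    (le := fun a b => x a <= x b) :
  (0 < nmem s vw 0)%N -> slice (nmem s aP) 0 n = flatten rs ->
  runs_of_width (nmem s vw 0) rs ->
  runs merge_pass s (5 + (n * 10).+1)
    (fun s' => slice (nmem s' aB) 0 n = flatten (merge_pairs le rs)).
Proof.
move=> w0 rsE rs_w.
have init T Q c s0 v e : runs c (State (update (nmem s0) v 0 (neval s0 e))
    (rmem s0) (asked s0)) T Q -> runs (v ::= e ;; c) s0 (1 + T) Q.
  by move=> H; apply: runs_seq; apply: (@runs_wp _ ask tau (v ::= e)).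
do 5 apply: (@init).
set s1 := State _ _ _.
have := @runs_while R ask tau
  (merge_inv n (nmem s vw 0) (nmem s aP) x (flatten (merge_pairs le rs)))
  (lt (val vo) len) (load_runs ;; output_min) 9 n s1.
move=> H; apply: runs_mono (H _ _) => //.
- move=> s' [m [[nE _ _ _ om e2n pos [rest [restE rest_w out]]]]] /=.
  rewrite nE => b; have oE : nmem s' vo 0 = n by lia.
  rewrite -out oE (_ : nmem s' ve1 0 - nmem s' vi 0 = 0)%N; last lia.
  rewrite (_ : nmem s' ve2 0 - nmem s' vj 0 = 0)%N; last lia.
  (* With [vo = n], [mi_pos] and [mi_e2] force [ve2 = n], so [flatten rest] has length 0. *)
  rewrite /= -[LHS]cats0; congr cat; apply/esym/size0nil.
  by rewrite size_flatten_merge_pairs -restE size_slice; lia.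
- move=> m s' _ inv /= b.
  have m0 : (0 < m)%N by case: inv b => -> _ _ _ om _ _ _; lia.
  split=> //; rewrite -[9%N]/(5 + 4)%N; apply: runs_seq.
  apply: runs_mono (runs_load_runs m0 w0 inv) => // s2 [inv2 loaded].
  exact: runs_output_min.
- split=> //.
  exists rs; split=> //=; first by rewrite /update /= subn0.
Qed.

Lemma runs_sort_examples k S M : (size S <= 2 ^ M)%N ->
  runs sort_examples (input k S)
    ((size S * 3).+1 + (1 + (M * (5 + (size S * 10).+1
       + (1 + (size S * 3).+1) + 1).+1).+1))
    (fun s => perm_eq (slice (nmem s aP) 0 (size S)) (iota 0 (size S)) /\
       sorted (fun a b => nth 0 S a <= nth 0 S b)
         (slice (nmem s aP) 0 (size S))).
Proof.
move=> n2M; set n := size S; set s0 := input k S; set x := nth 0 S.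
set le := fun a b => x a <= x b.
have fillP := @runs_fill aP (val vo) id s0 isT erefl (fun _ _ => erefl).
apply: runs_seq; apply: runs_mono (runs_frame fillP) => // s1 [F1 P1] {fillP}.
have N1 : nmem s1 aN = nmem s0 aN by have [-> //] := F1.
apply: runs_seq; apply: (@runs_wp _ ask tau (vw ::= NConst 1)) => /=.
set s2 := State _ _ _.
have n2 : nmem s2 aN 0 = n by rewrite /s2 /update /= N1.
have x2 : rmem s2 0%N = x by rewrite /s2 /=; have [_ -> //] := F1.
(* The width doubles in each pass, so [n <= w * 2 ^ m] survives with one pass less to go; while
   [w < n] it forces [m > 0]. *)
have := @runs_while R ask tau (fun m s =>
  (0 < nmem s vw 0)%N /\ (n <= nmem s vw 0 * 2 ^ m)%N /\
  exists rs, [/\ slice (nmem s aP) 0 n = flatten rs,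
    runs_of_width (nmem s vw 0) rs, all (sorted le) rs
    & perm_eq (flatten rs) (iota 0 n)])
  (lt (val vw) len) sort_round (5 + (n * 10).+1 + (1 + (n * 3).+1) + 1) M s2.
move=> H; apply: runs_mono (runs_frame (H _ _)) => // {H}.
- move=> s [F [m [[w0 [_ [rs [rsE rs_w rs_s rs_p]]]]]]] /= b.
  rewrite rsE; split=> //; apply: (sorted_single_run rs_w rs_s).
  have nE : nmem s aN 0 = n by have [-> //] := F.
  by rewrite -rsE size_slice; lia.
- move=> m s F [w0 [w_m [rs [rsE rs_w rs_s rs_p]]]] /= b.
  have ns : nmem s aN 0 = n by have [-> //] := F.
  have xs : rmem s 0%N = x by have [_ -> //] := F.
  have m0 : (0 < m)%N by case: m w_m => //; rewrite expn0; lia.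
  split=> //; rewrite -addnA; apply: runs_seq.
  have := runs_merge_pass w0 _ rs_w; rewrite ns xs => /(_ rsE) Hp.
  apply: runs_mono (runs_frame Hp) => // s3 [F3 B3] {Hp}.
  have w3 : nmem s3 vw = nmem s vw by have [-> //] := F3.
  have n3 : nmem s3 aN 0 = n by have [-> //] := F3.
  apply: runs_seq; apply: runs_seq.
  apply: (@runs_wp _ ask tau (vo ::= NConst 0)) => /=.
  set s4 := State _ _ _.
  have n4 : nmem s4 aN 0 = n by rewrite /s4 /update /= n3.
  have := @runs_fill aP (NGet aB (val vo)) (nmem s3 aB) s4.
  rewrite n4 => H4; apply: runs_mono (runs_frame (H4 _ _ _)) => // {H4}.
    move=> s5 [F5 P5]; apply: (@runs_wp _ ask tau (vw ::= _)) => /=.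
    have w5 : nmem s5 vw = nmem s vw by have [-> //] := F5.
    have rs5 : slice (nmem s5 aP) 0 n = flatten (merge_pairs le rs).
      by rewrite -B3; apply: eq_slice => i; rewrite add0n; apply: P5.
    rewrite /update /= w5; split; first lia.
    split; first by move: w_m; rewrite -(prednK m0) expnS /=; lia.
    exists (merge_pairs le rs); split=> //.
    + exact: runs_of_width_merge_pairs.
    + by apply: sorted_merge_pairs => // a c; rewrite /le le_total.
    + exact: perm_trans (perm_flatten_merge_pairs _ _) rs_p.
  by move=> s' [F5 _ _] /=; rewrite F5.
- rewrite /s2 /update /= mul1n; split=> //; split=> //.
  exists [seq [:: i] | i <- iota 0 n]; rewrite flatten_map1 map_id; split=> //.
  + rewrite -[RHS]map_id; apply: eq_slice => i; rewrite add0n; apply: P1.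
  + exact: runs_of_width1.
  + by rewrite all_map; apply/allP.
Qed.

End Program.

(** * Labelling the sorted examples *)

(** Positions from [vp] up to but excluding [vlo] are known to have label [z]; if [vhi] is below n,
    the query reaching up to example [vhi] has failed. *)
Definition search_step (z : bool) : cmd :=
  vmid ::= NHalf (NAdd (val vlo) (val vhi)) ;;
  Query vans (NConst 0)
    (Interval (BSide true (example (val vp)))
       (BSide false (example (val vmid)))) z ;;
  If (BLeN (NConst 1) (val vans))
     (vlo ::= NAdd (val vmid) (NConst 1)) (vhi ::= val vmid).

Definition write_labels (z : bool) : cmd :=
  While (lt (val vp) (val vlo))
    (SetN aOut (NGet aP (val vp)) (NConst (nat_of_bool z)) ;; incr vp).

Definition phase (z : bool) : cmd :=
  (vlo ::= val vp ;; vhi ::= len) ;;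
  While (lt (val vlo) (val vhi)) (search_step z) ;;
  write_labels z.

(** The test [vr <= k] gives k + 1 rounds. Rounds that start with every example labelled ask
    nothing, since [vlo] and [vhi] are then equal. *)
Definition label_examples : cmd :=
  While (BLeN (val vr) (NGet aN (NConst 1)))
    (phase true ;; phase false ;; incr vr).

(** * Correctness and cost of the binary search and of a phase *)

Section Search.
Context (R : realType) (ask : labeler R) (tau : nat).
Context (h : R -> bool) (L : set R) (n : nat) (f : nat -> nat) (x : nat -> R).
Context (askP : labeler_for L h ask).
Context (x_mono : forall i j, (i <= j < n)%N -> x (f i) <= x (f j)).
Context (x_L : forall j, (j < n)%N -> L (x (f j))).
Implicit Types (s : state R).
Local Notation runs := (runs ask tau).

Definition sorted_input s : Prop :=
  [/\ nmem s aN 0 = n, nmem s aP = f & rmem s 0%N = x].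

Definition labelled s : Prop := forall j, (j < nmem s vp 0)%N ->
  nmem s aOut (f j) = nat_of_bool (h (x (f j))).

Definition asks_intervals s : Prop :=
  forall e, e \in asked s -> interval_queries e.1.

(** [m] bounds the queries this search may still make, and [Q] the length of the transcript at its
    end. The witness in [si_hi] comes from a failed query and need not be an example. *)
Record search_inv (z : bool) (p Q m : nat) s : Prop := SearchInv {
  si_input : sorted_input s;
  si_p : nmem s vp 0 = p;
  si_bounds : (p <= nmem s vlo 0 <= nmem s vhi 0)%N /\ (nmem s vhi 0 <= n)%N;
  si_width : (nmem s vhi 0 - nmem s vlo 0 < 2 ^ m)%N;
  si_lo : forall j, (p <= j < nmem s vlo 0)%N -> h (x (f j)) = z;
  si_hi : (nmem s vhi 0 < n)%N ->
    exists y, x (f p) <= y <= x (f (nmem s vhi 0)) /\ h y = ~~ z;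
  si_asked : (size (asked s) + m <= Q)%N;
  si_intervals : asks_intervals s
}.

Lemma runs_search_step z p Q m s :
  search_inv z p Q m s -> (nmem s vlo 0 < nmem s vhi 0)%N ->
  (0 < m)%N /\ runs (search_step z) s (tau + 3) (search_inv z p Q m.-1).
Proof.
move=> [[nE fE xE] pE [/andP[p_lo lo_hi] hi_n] width lo_z hi_z askQ itvs] lt_lh.
have m0 : (0 < m)%N by case: m width {askQ} => //; rewrite expn0; lia.
split=> //.
have := @runs_wp R ask tau (search_step z) s (search_inv z p Q m.-1).
move=> H; apply: runs_mono (H _) => //; first by rewrite /=; lia.
rewrite {H} /= /query_of /= /update /= fE xE pE.
set mid := (_./2); set q := (_, z); set ans := ask _ q.
have mid_lo : (nmem s vlo 0 <= mid)%N by rewrite /mid; lia.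
have mid_hi : (mid < nmem s vhi 0)%N by rewrite /mid; lia.
(* Whatever the answer, at most half of the width remains, so the strict bound on it drops from 2^m
   to 2^(m-1). *)
have width2 : (2 ^ m = 2 * 2 ^ m.-1)%N by rewrite -expnS prednK.
have p_mid : x (f p) <= x (f mid) by apply: x_mono; lia.
have qP : ans = true <->
    (forall y, ([set` `[x (f p), x (f mid)]] `&` L) y -> h y = z).
  (* Example p lies in both the region and [L], so the answer is not one of those left arbitrary. *)
  apply: askP; exists (x (f p)); split; last by apply: x_L; lia.
  by rewrite /= in_itv /= lexx.
have itvs' : forall e, e \in (q, ans) :: asked s -> interval_queries e.1.
  move=> e; rewrite in_cons => /orP[/eqP ->|]; last exact: itvs.
  exact: interval_is_interval.
case ansE : ans itvs' => /= itvs'.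
- split=> //=; rewrite /update /=; try lia.
  move=> j /andP[p_j j_mid].
  have [+ _] := qP; move=> /(_ ansE); apply; split; last by apply: x_L; lia.
  by rewrite /= in_itv /= !x_mono //; lia.
- split=> //=; rewrite /update /=; try lia.
  move=> _; apply: contrapT => no_y.
  suff : ans = true by rewrite ansE.
  apply/qP => y [+ _]; rewrite /= in_itv /= => y_in.
  apply: contrapT => hy; apply: no_y; exists y; split=> //.
  by move: hy; case: (h y); case: z {lo_z hi_z q ans qP ansE itvs'}.
Qed.

Lemma runs_write_labels z s : sorted_input s -> labelled s ->
  (nmem s vp 0 <= nmem s vlo 0 <= n)%N ->
  (forall j, (nmem s vp 0 <= j < nmem s vlo 0)%N -> h (x (f j)) = z) ->
  runs (write_labels z) s (n * 3).+1
    (fun s' => labelled s' /\ nmem s' vp 0 = nmem s vlo 0).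
Proof.
move=> [nE fE xE] lab /andP[p_lo lo_n] lo_z; set p := nmem s vp 0.
have := @runs_while R ask tau (fun m s' =>
  [/\ (nmem s' vp 0 + m = nmem s vlo 0)%N, (p <= nmem s' vp 0)%N & labelled s'])
  (lt (val vp) (val vlo))
  (SetN aOut (NGet aP (val vp)) (NConst (nat_of_bool z)) ;; incr vp)
  2 (nmem s vlo 0 - p) s.
move=> H; apply: runs_mono (runs_frame (H _ _)) => // {H}.
- by rewrite ltnS leq_pmul2r //; lia.
- move=> s' [[F _ _] [m [[pm p_s' lab'] /= b]]]; split=> //.
  have loE : nmem s' vlo = nmem s vlo by rewrite F.
  by rewrite loE in b; lia.
- move=> m s' [F _ _] [pm p_s' lab'] /= b.
  have loE : nmem s' vlo = nmem s vlo by rewrite F.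
  have fE' : nmem s' aP = f by rewrite F.
  rewrite loE in b; split; first lia.
  apply: runs_wp; split=> /=; rewrite /update /=; try lia.
  rewrite /labelled /= /update /= => j j_p.
  (* If [f j] is the index just written, both positions carry the same example, whose label is [z];
     otherwise [j] was labelled before. *)
  rewrite fE'; case: eqP => [->|j_neq /=].
    by rewrite lo_z //; lia.
  apply: lab'; have : j != nmem s' vp 0.
    by apply/eqP => jE; apply: j_neq; rewrite jE.
  by lia.
- by split=> //; lia.
Qed.

(** The point [y] witnesses why the block ends where it does; two such points, one from each phase
    of a round, drive the count of rounds. *)
Definition phase_post (z : bool) (M : nat) s s' : Prop :=
  [/\ sorted_input s', (nmem s vp 0 <= nmem s' vp 0 <= n)%N, labelled s',
      asks_intervals s' & (size (asked s') <= size (asked s) + M)%N] /\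
  ((nmem s' vp 0 < n)%N -> exists y,
      x (f (nmem s vp 0)) <= y <= x (f (nmem s' vp 0)) /\ h y = ~~ z).

Lemma runs_phase z M s : (n < 2 ^ M)%N ->
  sorted_input s -> (nmem s vp 0 <= n)%N -> labelled s -> asks_intervals s ->
  runs (phase z) s (2 + ((M * (tau + 3).+1).+1 + (n * 3).+1))
    (phase_post z M s).
Proof.
move=> n_M [nE fE xE] p_n lab itvs.
apply: runs_seq; apply: (@runs_wp _ ask tau (_ ;; _)) => /=.
rewrite /update /= nE.
set s1 := State _ _ _.
have := @runs_while R ask tau
  (search_inv z (nmem s vp 0) (size (asked s) + M))
  (lt (val vlo) (val vhi)) (search_step z) (tau + 3) M s1.
move=> H; apply: runs_seq; apply: runs_mono (runs_frame (H _ _)) => // {H}.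
- move=> s2 [[F _ _] [m [inv /= b]]].
  case: inv => in2 p2 [/andP[p_lo lo_hi] hi_n] _ lo_z hi_z askQ itvs2.
  (* The search ends with [vlo = vhi], so the failed query reaches exactly the first example left
     unlabelled. *)
  have hiE : nmem s2 vhi 0 = nmem s2 vlo 0 by lia.
  rewrite hiE in hi_z hi_n.
  have out2 : nmem s2 aOut = nmem s aOut by rewrite F.
  have lab2 : labelled s2.
    by move=> j; rewrite p2 out2; apply: lab.
  rewrite -p2 in p_lo lo_z.
  have p_lo_n : (nmem s2 vp 0 <= nmem s2 vlo 0 <= n)%N by rewrite p_lo.
  apply: runs_mono (runs_frame (runs_write_labels in2 lab2 p_lo_n lo_z)) => //.
  move=> s3 [[F3 R3 A3] [lab3 p3]].
  have [n2E f2E x2E] := in2.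
  have asked3 : asked s3 = asked s2 by apply: A3.
  split; [split=> // | ].
  + split; by rewrite ?F3 ?R3.
  + by rewrite p3 -p2.
  + by rewrite /asks_intervals asked3.
  + by rewrite asked3; lia.
  + by rewrite p3.
- move=> m s2 _ inv /= b; apply: runs_search_step => //; lia.
- split=> //=; try lia.
Qed.

(** * The number of rounds, counted by left ends of intervals *)

Section Rounds.
Context (k : nat) (a b : 'I_k -> R).
Context (h_union :
  forall y, h y = true <-> (\bigcup_(i : 'I_k) [set` `[a i, b i]]) y).

(** A potential bounded by k: each round that leaves an example over raises its value at the first
    unlabelled example. *)
Definition opened (y : R) : nat := #|[set i : 'I_k | a i <= y]%SET|.

(* The interval that contains [y'] opens after [y]. *)
Lemma opened_lt y y' u v : u <= y <= y' -> y' <= v ->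
  h y = false -> h y' = true -> (opened u < opened v)%N.
Proof.
move=> /andP[u_y y_y'] y'_v hy /h_union[i _].
rewrite /= in_itv /= => /andP[ai bi].
have a_y : y < a i.
  rewrite ltNge; apply/negP => a_y; suff : h y = true by rewrite hy.
  by apply/h_union; exists i => //; rewrite /= in_itv /= a_y (le_trans y_y').
apply: proper_card; apply/properP; split.
  apply/fintype.subsetP => j; rewrite !inE => /le_trans; apply.
  by rewrite (le_trans u_y) ?(le_trans y_y').
exists i; rewrite !inE; first exact: le_trans ai y'_v.
by rewrite -ltNge (le_lt_trans u_y).
Qed.

Lemma runs_label_examples M s : (n < 2 ^ M)%N -> nmem s aN 1 = k ->
  sorted_input s -> nmem s vp 0 = 0%N -> nmem s vr 0 = 0%N -> asked s = [::] ->
  runs label_examples s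
    (k.+1 * (2 + ((M * (tau + 3).+1).+1 + (n * 3).+1) +
       (2 + ((M * (tau + 3).+1).+1 + (n * 3).+1) + 1)).+1).+1
    (fun s' => [/\ forall j, (j < n)%N ->
                     nmem s' aOut (f j) = nat_of_bool (h (x (f j))),
                  asks_intervals s' & (size (asked s') <= k.+1 * (2 * M))%N]).
Proof.
move=> n_M kE in_s p0 r0 ask0.
have := @runs_while R ask tau (fun m s' =>
  [/\ (nmem s' vr 0 + m = k.+1)%N, sorted_input s' /\ labelled s',
      (nmem s' vp 0 <= n)%N,
      (nmem s' vp 0 < n)%N -> (nmem s' vr 0 <= opened (x (f (nmem s' vp 0))))%N
    & asks_intervals s' /\ (size (asked s') <= nmem s' vr 0 * (2 * M))%N])
  (BLeN (val vr) (NGet aN (NConst 1)))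
  (phase true ;; phase false ;; incr vr)
  (2 + ((M * (tau + 3).+1).+1 + (n * 3).+1) +
       (2 + ((M * (tau + 3).+1).+1 + (n * 3).+1) + 1)) k.+1 s.
move=> H; apply: runs_mono (runs_frame (H _ _)) => // {H}.
- move=> s' [[F _ _] [m [[rm [in_s' lab] p_n p_opened [itvs askQ]]]]] /= bF.
  have kE' : nmem s' aN 1 = k by rewrite F.
  have rE : nmem s' vr 0 = k.+1 by lia.
  split=> //; last by rewrite -rE.
  move=> j j_n; apply: lab; case: (ltnP (nmem s' vp 0) n) => [p_lt|]; last lia.
  (* An example still unlabelled would have at least k + 1 of the k left ends at or below it. *)
  have := p_opened p_lt.
  have := max_card (mem [set i : 'I_k | a i <= x (f (nmem s' vp 0))]%SET).
  by rewrite card_ord -/(opened _); lia.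
- move=> m s' [F _ _] [rm [in_s' lab] p_n p_opened [itvs askQ]] /= bT.
  have kE' : nmem s' aN 1 = k by rewrite F.
  split; first lia.
  apply: runs_seq.
  apply: runs_mono (runs_frame (runs_phase true n_M in_s' p_n lab itvs)) => //.
  move=> s1 [[F1 _ _] [[in1 /andP[p01 p1_n] lab1 itvs1 ask1] y1P]].
  apply: runs_seq.
  apply: runs_mono
    (runs_frame (runs_phase false n_M in1 p1_n lab1 itvs1)) => //.
  move=> s2 [[F2 _ _] [[in2 /andP[p12 p2_n] lab2 itvs2 ask2] y2P]].
  have r2 : nmem s2 vr = nmem s' vr by rewrite F2 // F1.
  apply: (@runs_wp _ ask tau (incr vr)) => /=.
  split=> //=; rewrite /update /= ?r2; try lia.
  + move=> p2_lt; have p1_lt : (nmem s1 vp 0 < n)%N by lia.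
    have [y1 [/andP[p_y1 y1_p1] hy1]] := y1P p1_lt.
    have [y2 [/andP[p1_y2 y2_p2] hy2]] := y2P p2_lt.
    have y12 : x (f (nmem s' vp 0)) <= y1 <= y2.
      by rewrite p_y1 (le_trans y1_p1).
    have := opened_lt y12 y2_p2 hy1 hy2.
    have : (nmem s' vp 0 < n)%N by lia.
    by move=> /p_opened; lia.
  + by split=> //; lia.
- rewrite p0 r0 ask0 /=; split=> //; split=> //.
  + by move=> j; rewrite p0.
  + by rewrite /asks_intervals ask0.
Qed.

End Rounds.
End Search.

(** * Estimates for the logarithm and the total time *)

Lemma trunc_log_le_log1 (R : realType) (n : nat) :
  (trunc_log 2 n).+1%:R <= 3 * log1 R n.
Proof.
set m := trunc_log 2 n.
have log1_ge1 : 1 <= log1 R n by rewrite /log1 le_max lexx.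
(* The successor is paid for by [1 <= log1 R n]; the factor 2 comes from [ln 2 >= 1/2]. *)
suff : m%:R <= 2 * log1 R n by rewrite -natr1; lra.
case: (posnP n) => [n0|n_gt0].
  have -> : m = 0%N by rewrite /m n0 trunc_log0.
  by lra.
have ln_n : ln (n%:R : R) <= log1 R n by rewrite /log1 le_max lexx orbT.
have ln2 : (1 / 2 : R) <= ln 2.
  (* The bound 1 + x <= exp x at x = - ln 2 gives 1 - ln 2 <= 1/2. *)
  have : 1 - ln (2 : R) <= expR (- ln 2).
    by have := expR_ge1Dx (- ln (2 : R)); lra.
  rewrite expRN lnK ?posrE //; lra.
have : m%:R * ln (2 : R) <= ln n%:R.
  rewrite mulr_natl -lnXn // ler_ln ?posrE ?exprn_gt0 ?ltr0n //.
  by rewrite -natrX ler_nat trunc_logP.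
have : m%:R * (1 / 2) <= m%:R * ln (2 : R) by rewrite ler_wpM2l.
lra.
Qed.

(** Once multiplied out, every term on the left is at most a multiple of k M tau or of k n M. The
    product inequalities in the proof make this linear in the monomials. *)
Lemma total_time_le (tau n k M : nat) : (0 < tau)%N -> (0 < k)%N -> (0 < M)%N ->
  ((n * 3).+1 + (1 + (M * (5 + (n * 10).+1 + (1 + (n * 3).+1) + 1).+1).+1) +
   (k.+1 * (2 + ((M * (tau + 3).+1).+1 + (n * 3).+1) +
      (2 + ((M * (tau + 3).+1).+1 + (n * 3).+1) + 1)).+1).+1
     <= 100 * ((tau + n) * k * M))%N.
Proof.
move=> tau0 k0 M0.
have kM_tau : (k * M <= k * M * tau)%N by rewrite leq_pmulr.
have kn_M : (k * n <= k * n * M)%N by rewrite leq_pmulr.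
have k_M : (k <= k * M)%N by rewrite leq_pmulr.
have Mtau_k : (M * tau <= k * (M * tau))%N by rewrite leq_pmull.
have M_k : (M <= k * M)%N by rewrite leq_pmull.
have n_k : (n <= k * n)%N by rewrite leq_pmull.
have nM_k : (n * M <= k * (n * M))%N by rewrite leq_pmull.
lia.
Qed.

(** * The learner and its bounds *)

Definition learner : cmd := sort_examples ;; label_examples.

Theorem theorem3p1 (R : realType) :
  exists (A : cmd) (C : R),
    forall (k : nat) (S : seq R) (h : R -> bool) (L : set R)
           (tau : nat) (ask : labeler R),
      (0 < k)%N -> uniq S -> unions_of_intervals k h ->
      [set` S] `<=` L -> (0 < tau)%N -> labeler_for L h ask ->
      exists (t : nat) (s : state R),
        [/\ exec ask tau A (input k S) t s,
            t%:R <= C * ((tau + size S)%:R * k%:R * log1 R (size S)),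
            (size (asked s))%:R <= C * (k%:R * log1 R (size S)),
            (forall e, e \in asked s -> interval_queries e.1) &
            labels_correctly h S s].
Proof.
(* The constant is 100 * 3, from [total_time_le] and [trunc_log_le_log1]. For the queries 4 * 3 is
   enough, as 2(k + 1)M <= 4kM. *)
exists learner, 300 => k S h L tau ask k0 _ [a [b h_union]] S_L tau0 askP.
(* [M] bounds both the number of merge passes and the number of queries in one binary search. *)
set n := size S; set M := (trunc_log 2 n).+1.
have n_M : (n < 2 ^ M)%N by apply: trunc_log_ltn.
have sortP := runs_sort_examples ask tau k (ltnW n_M).
set T1 := (X in runs _ _ _ _ X _) in sortP.
have [t [s [E tT [itvs askQ lab]]]] : runs ask tau learner (input k S)
    (T1 + (k.+1 * (2 + ((M * (tau + 3).+1).+1 + (n * 3).+1) +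
       (2 + ((M * (tau + 3).+1).+1 + (n * 3).+1) + 1)).+1).+1)
    (fun s => [/\ asks_intervals s, (size (asked s) <= k.+1 * (2 * M))%N
      & labels_correctly h S s]).
  apply: runs_seq; apply: runs_mono (runs_frame sortP) => // s1.
  move=> [[F1 R1 A1] [perm_P sorted_P]].
  have x_mono i j : (i <= j < n)%N ->
      nth 0 S (nmem s1 aP i) <= nth 0 S (nmem s1 aP j).
    move=> /andP[ij jn]; have i_n : (i < n)%N by lia.
    rewrite -(nth_slice (nmem s1 aP) i_n) -(nth_slice (nmem s1 aP) jn).
    apply: (sorted_leq_nth (leT := fun a b => nth 0 S a <= nth 0 S b)).
    all: rewrite ?unfold_in /= ?size_slice //.
    by move=> ? ? ?; apply: le_trans.
  have x_L j : (j < n)%N -> L (nth 0 S (nmem s1 aP j)).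
    move=> j_n; apply: S_L => /=; apply: mem_nth.
    have : nmem s1 aP j \in iota 0 n.
      rewrite -(perm_mem perm_P) -(nth_slice (nmem s1 aP) j_n) mem_nth //.
      by rewrite size_slice.
    by rewrite mem_iota.
  have in1 : sorted_input n (nmem s1 aP) (nth 0 S) s1.
    by split; [rewrite F1 | | rewrite R1].
  have kE : nmem s1 aN 1 = k by rewrite F1.
  have p0 : nmem s1 vp 0 = 0%N by rewrite F1.
  have r0 : nmem s1 vr 0 = 0%N by rewrite F1.
  have q0 : asked s1 = [::] by rewrite A1.
  have := runs_label_examples tau askP x_mono x_L h_union n_M kE in1 p0 r0 q0.
  apply: runs_mono => //.
  move=> s [lab itvs askQ]; split=> // i i_n.
  (* The sorted order is a permutation, so each input index occurs at some sorted position, where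
     its label has been written. *)
  have : i \in slice (nmem s1 aP) 0 n by rewrite (perm_mem perm_P) mem_iota.
  move=> /mapP[j]; rewrite mem_iota => j_n ->; exact: lab.
have := trunc_log_le_log1 R n; rewrite -/M => M_log.
exists t, s; split=> //.
- have tN : (t <= 100 * ((tau + n) * k * M))%N.
    exact: leq_trans tT (total_time_le _ _ _ _).
  apply: (@le_trans _ _ (100 * ((tau + n) * k * M))%:R).
    by rewrite ler_nat.
  rewrite !natrM.
  have := ler_wpM2l (_ : 0 <= (tau + n)%:R * k%:R) M_log.
  rewrite -natrM ler0n => /(_ isT); rewrite !natrM; lra.
- apply: (@le_trans _ _ (4 * (k * M))%:R).
    by rewrite ler_nat; apply: leq_trans askQ _; nia.
  rewrite !natrM.
  have := ler_wpM2l (_ : 0 <= k%:R) M_log; rewrite ler0n => /(_ isT).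
  have : 0 <= k%:R * log1 R n by rewrite mulr_ge0 // /log1 le_max ler01.
  lra.
Qed.
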